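(* Let $H$ be an infinite-dimensional complex separable Hilbert space and let $T\in\mathcal{B}(H)$ be idempotent, i.e. $T^2=T$. Then the following are equivalent: (i) $T\in\mathcal{AN}(H)$; (ii) either the range $R(T)$ or the kernel $N(T)$ is finite dimensional; (iii) $T\in\mathcal{AM}(H)$; (iv) $T\in\overline{\mathcal{AN}(H)}$.
   Context: $\mathcal{B}(H)$ denotes bounded linear operators on $H$ with the operator norm. $T\in\mathcal{B}(H)$ is norm attaining if $\|Tx\|=\|T\|$ for some unit vector $x$; $T\in\mathcal{AN}(H)$ (absolutely norm attaining) if for every nonzero closed subspace $M\subseteq H$ the restriction $T|_M:M\to H$ is norm attaining. The minimum modulus is $m(T)=\inf\{\|Tx\|:\|x\|=1\}$; $T$ is minimum attaining if $\|Tx\|=m(T)$ for some unit vector $x$; $T\in\mathcal{AM}(H)$ (absolutely minimum attaining) if for every nonzero closed subspace $M\subseteq H$ the restriction $T|_M$ is minimum attaining. $\overline{\mathcal{AN}(H)}$ is the operator-norm closure of $\mathcal{AN}(H)$. *)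

(* Defs.v *)
From HB Require Import structures.
From mathcomp Require Import all_boot all_order all_algebra.
From mathcomp Require Import complex.
From mathcomp Require Import boolp classical_sets reals.
Set Implicit Arguments. Unset Strict Implicit. Unset Printing Implicit Defensive.
Import Order.TTheory GRing.Theory Num.Theory.
Local Open Scope ring_scope.
Local Open Scope classical_set_scope.

Section Hilbert.
Variables (R : realType) (V : lmodType R[i]) (ip : V -> V -> R[i]).

Definition hnorm (x : V) : R := Num.sqrt (complex.Re (ip x x)).

Definition is_inner_product : Prop :=
  [/\ forall (a : R[i]) (x y z : V), ip (a *: x + y) z = a * ip x z + ip y z,
      forall x y : V, ip y x = conjc (ip x y),
      forall x : V, 0 <= complex.Re (ip x x) /\ complex.Im (ip x x) = 0
    & forall x : V, ip x x = 0 -> x = 0].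

Definition cauchy_seq (u : nat -> V) : Prop :=
  forall e : R, 0 < e -> exists N : nat, forall m n : nat,
    (N <= m)%N -> (N <= n)%N -> hnorm (u m - u n) < e.

Definition converges_to (u : nat -> V) (l : V) : Prop :=
  forall e : R, 0 < e -> exists N : nat, forall n : nat,
    (N <= n)%N -> hnorm (u n - l) < e.

Definition complete : Prop :=
  forall u : nat -> V, cauchy_seq u -> exists l : V, converges_to u l.

Definition separable : Prop :=
  exists d : nat -> V, forall (x : V) (e : R), 0 < e ->
    exists n : nat, hnorm (x - d n) < e.

Definition lin_indep (n : nat) (v : 'I_n -> V) : Prop :=
  forall c : 'I_n -> R[i], \sum_(i < n) c i *: v i = 0 -> forall i, c i = 0.

Definition infinite_dim : Prop :=
  forall n : nat, exists v : 'I_n -> V, lin_indep v.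

Definition inf_dim_separable_Hilbert : Prop :=
  [/\ is_inner_product, complete, separable & infinite_dim].

Definition fin_dim (S : set V) : Prop :=
  exists (n : nat) (v : 'I_n -> V), forall x, S x ->
    exists c : 'I_n -> R[i], x = \sum_(i < n) c i *: v i.

Definition op_range (T : V -> V) : set V := [set y | exists x, y = T x].
Definition kernel (T : V -> V) : set V := [set x | T x = 0].

Definition bounded (T : V -> V) : Prop :=
  exists C : R, forall x : V, hnorm (T x) <= C * hnorm x.

Definition closed_subspace (M : set V) : Prop :=
  [/\ M 0,
      forall (a : R[i]) (x y : V), M x -> M y -> M (a *: x + y)
    & forall (u : nat -> V) (l : V), (forall n, M (u n)) -> converges_to u l -> M l].

Definition nonzero_set (M : set V) : Prop := exists x, M x /\ x <> 0.

Definition rnorm (M : set V) (T : V -> V) : R :=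
  sup [set r | exists x, [/\ M x, hnorm x = 1 & r = hnorm (T x)]].
Definition rminmod (M : set V) (T : V -> V) : R :=
  inf [set r | exists x, [/\ M x, hnorm x = 1 & r = hnorm (T x)]].

Definition opnorm (T : V -> V) : R := rnorm setT T.

Definition norm_attaining_on (M : set V) (T : V -> V) : Prop :=
  exists x, [/\ M x, hnorm x = 1 & hnorm (T x) = rnorm M T].
Definition min_attaining_on (M : set V) (T : V -> V) : Prop :=
  exists x, [/\ M x, hnorm x = 1 & hnorm (T x) = rminmod M T].

Definition AN (T : {linear V -> V}) : Prop :=
  bounded T /\ forall M, closed_subspace M -> nonzero_set M -> norm_attaining_on M T.
Definition AM (T : {linear V -> V}) : Prop :=
  bounded T /\ forall M, closed_subspace M -> nonzero_set M -> min_attaining_on M T.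

Definition in_closure_AN (T : {linear V -> V}) : Prop :=
  forall e : R, 0 < e -> exists S : {linear V -> V},
    AN S /\ opnorm (fun x => T x - S x) < e.

End Hilbert.

(* Main.v *)
(* Two constructions give the equivalence.

   If R(T) or N(T) is finite dimensional then T = c I + F with F of finite rank
   and c = 0 or 1.  On a closed subspace M, the vectors killed by F and
   orthogonal to the range of F form a closed subspace N of finite codimension
   in M, and |T(p + z)|^2 = |c|^2 |p|^2 + |T z|^2 for p in N and z in the
   finite-dimensional space M cap N^perp.  In a basis of singular vectors of T
   on the latter, |T x|^2 for unit x in M becomes a convex combination of
   finitely many attained values, so its extrema are attained.

   Conversely, suppose |S x|^2 <= a on the unit sphere of K1 and |S x|^2 >= b > a
   on that of K2, with K1 and K2 both infinite dimensional.  Mixing vectors of K1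
   and K2 gives, for every sequence lam in [a, b], an orthonormal sequence g with
   <S g_m, S g_n> = lam_n delta_mn.  If lam increases strictly to b, then
   |S x|^2 < b on the unit sphere of the closed span of g while the supremum is b,
   so S is not AN; symmetrically for lam decreasing to a and AM.  This applies
   with K1 = N(T), K2 = R(T) to S = T and to every S within 1/4 of T. *)

Require Import Defs.
From HB Require Import structures.
From mathcomp Require Import all_boot all_order all_algebra.
From mathcomp Require Import complex.
From mathcomp Require Import boolp classical_sets reals.
From mathcomp Require Import ring lra.
Import Order.TTheory GRing.Theory Num.Theory.
Local Open Scope ring_scope.
Set Implicit Arguments.
Unset Strict Implicit.
Unset Printing Implicit Defensive.

(** * Real parts, conjugates and squared moduli of complex numbers *)

Section ComplexParts.
Variable R : realType.
Implicit Types a b : R[i].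

Definition cnsq a : R := complex.Re a ^+ 2 + complex.Im a ^+ 2.

Lemma ReD a b : complex.Re (a + b) = complex.Re a + complex.Re b.
Proof. by case: a; case: b. Qed.

Lemma ReN a : complex.Re (- a) = - complex.Re a.
Proof. by case: a. Qed.

Lemma Re_sum (I : finType) (F : I -> R[i]) :
  complex.Re (\sum_i F i) = \sum_i complex.Re (F i).
Proof. by apply: (big_morph _ ReD). Qed.

Lemma ReJ a : complex.Re (conjc a) = complex.Re a.
Proof. by case: a. Qed.

Lemma Re_real_mul (r : R) a : complex.Re (real_complex R r * a) = r * complex.Re a.
Proof. by case: a => x y /=; rewrite mul0r subr0. Qed.

Lemma conjcD a b : conjc (a + b) = conjc a + conjc b.
Proof. exact: rmorphD. Qed.

Lemma conjcM a b : conjc (a * b) = conjc a * conjc b.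
Proof. exact: rmorphM. Qed.

Lemma conjcN a : conjc (- a) = - conjc a.
Proof. exact: rmorphN. Qed.

Lemma mulcJ a : a * conjc a = real_complex R (cnsq a).
Proof.
by case: a => x y; rewrite /cnsq /real_complex_def /=; congr (Complex _ _) => /=; ring.
Qed.

Lemma cnsq_ge0 a : 0 <= cnsq a.
Proof. by rewrite addr_ge0 ?sqr_ge0. Qed.

Lemma cnsq_eq0 a : cnsq a = 0 -> a = 0.
Proof.
case: a => x y; rewrite /cnsq /= => /eqP.
by rewrite paddr_eq0 ?sqr_ge0 // !sqrf_eq0 => /andP[/eqP-> /eqP->].
Qed.

Lemma cnsq0 : cnsq 0 = 0.
Proof. by rewrite /cnsq /= expr0n addr0. Qed.

Lemma cnsq_real (r : R) : cnsq (real_complex R r) = r ^+ 2.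
Proof. by rewrite /cnsq /= expr0n addr0. Qed.

Lemma Re_mulJ a : complex.Re (a * conjc a) = cnsq a.
Proof. by rewrite mulcJ. Qed.

Lemma sqr_Re_le_cnsq a : complex.Re a ^+ 2 <= cnsq a.
Proof. by rewrite lerDl sqr_ge0. Qed.

End ComplexParts.

(** * Inner products, norms and finite orthogonal families *)

Section InnerProduct.
Variables (R : realType) (V : lmodType R[i]) (ip : V -> V -> R[i]).
Hypothesis ipP : is_inner_product ip.
Implicit Types (x y z : V) (a b : R[i]).

Definition nsq x : R := complex.Re (ip x x).

Lemma ip_lin a x y z : ip (a *: x + y) z = a * ip x z + ip y z.
Proof. by case: ipP => ->. Qed.

Lemma ipC x y : ip y x = conjc (ip x y).
Proof. by case: ipP. Qed.

Lemma ipDl x y z : ip (x + y) z = ip x z + ip y z.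
Proof. by have := ip_lin 1 x y z; rewrite scale1r mul1r. Qed.

Lemma ip0l z : ip 0 z = 0.
Proof. by apply: (addrI (ip 0 z)); rewrite -ipDl !addr0. Qed.

Lemma ipZl a x z : ip (a *: x) z = a * ip x z.
Proof. by have := ip_lin a x 0 z; rewrite ip0l !addr0. Qed.

Lemma ipNl x z : ip (- x) z = - ip x z.
Proof. by rewrite -scaleN1r ipZl mulN1r. Qed.

Lemma ipBl x y z : ip (x - y) z = ip x z - ip y z.
Proof. by rewrite ipDl ipNl. Qed.

Lemma ip_suml (I : finType) (F : I -> V) z : ip (\sum_i F i) z = \sum_i ip (F i) z.
Proof. exact: (big_morph (ip^~ z) (fun x y => ipDl x y z) (ip0l z)). Qed.

Lemma ipDr x y z : ip z (x + y) = ip z x + ip z y.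
Proof. by rewrite ipC ipDl conjcD -!ipC. Qed.

Lemma ip0r z : ip z 0 = 0.
Proof. by rewrite ipC ip0l conjc0. Qed.

Lemma ipZr a x z : ip z (a *: x) = conjc a * ip z x.
Proof. by rewrite ipC ipZl conjcM -ipC. Qed.

Lemma ipNr x z : ip z (- x) = - ip z x.
Proof. by rewrite ipC ipNl conjcN -ipC. Qed.

Lemma ip_sumr (I : finType) (F : I -> V) z : ip z (\sum_i F i) = \sum_i ip z (F i).
Proof. exact: (big_morph (ip z) (fun x y => ipDr x y z) (ip0r z)). Qed.

Lemma ip_eq0C x y : ip x y = 0 -> ip y x = 0.
Proof. by move=> h; rewrite ipC h conjc0. Qed.

Lemma nsq_ge0 x : 0 <= nsq x.
Proof. by case: ipP => _ _ /(_ x)[]. Qed.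

Lemma ipxx x : ip x x = real_complex R (nsq x).
Proof.
by case: ipP => _ _ /(_ x)[_ h] _; rewrite /nsq; case: (ip x x) h => u v /= ->.
Qed.

Lemma nsq_eq0 x : nsq x = 0 -> x = 0.
Proof. by move=> h; case: ipP => _ _ _; apply; rewrite ipxx h. Qed.

Lemma nsq0 : nsq 0 = 0.
Proof. by rewrite /nsq ip0l. Qed.

Lemma nsq_gt0 x : x <> 0 -> 0 < nsq x.
Proof. by move=> x0; rewrite lt_def nsq_ge0 andbT; apply/eqP => /nsq_eq0. Qed.

Lemma nsqZ a x : nsq (a *: x) = cnsq a * nsq x.
Proof. by rewrite /nsq ipZl ipZr mulrA mulcJ Re_real_mul. Qed.

Lemma nsqN x : nsq (- x) = nsq x.
Proof. by rewrite /nsq ipNl ipNr opprK. Qed.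

Lemma nsqD x y : nsq (x + y) = nsq x + nsq y + 2 * complex.Re (ip x y).
Proof. by rewrite /nsq ipDl !ipDr !ReD (ipC x y) ReJ; ring. Qed.

Lemma nsqB x y : nsq (x - y) = nsq x + nsq y - 2 * complex.Re (ip x y).
Proof. by rewrite nsqD nsqN ipNr ReN mulrN. Qed.

Lemma pythagoras x y : ip x y = 0 -> nsq (x + y) = nsq x + nsq y.
Proof. by rewrite nsqD => ->; rewrite mulr0 addr0. Qed.

Lemma parallelogram x y : nsq (x + y) + nsq (x - y) = 2 * nsq x + 2 * nsq y.
Proof. by rewrite nsqD nsqB; ring. Qed.

(** The squared norm of [|y|^2 x - <x, y> y] is nonnegative and equals [|y|^2] times the difference
    of the two sides. *)
Lemma cauchy_schwarz x y : cnsq (ip x y) <= nsq x * nsq y.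
Proof.
have [->|/eqP y0] := eqVneq y 0; first by rewrite ip0r cnsq0 nsq0 mulr0.
have ny := nsq_gt0 y0.
have := nsq_ge0 (real_complex R (nsq y) *: x - ip x y *: y).
rewrite nsqB !nsqZ cnsq_real ipZl ipZr (mulrC (conjc _)) mulcJ Re_real_mul /= => h.
rewrite -subr_ge0 -(pmulr_rge0 _ ny); move: h; congr (_ <= _); ring.
Qed.

Lemma hnorm_ge0 x : 0 <= hnorm ip x.
Proof. exact: sqrtr_ge0. Qed.

Lemma sqr_hnorm x : hnorm ip x ^+ 2 = nsq x.
Proof. by rewrite sqr_sqrtr // nsq_ge0. Qed.

Lemma hnorm_le x y : (hnorm ip x <= hnorm ip y) = (nsq x <= nsq y).
Proof. by rewrite /hnorm ler_sqrt // nsq_ge0. Qed.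

Lemma hnorm_le_nsq x (c : R) : 0 <= c -> (hnorm ip x <= c) = (nsq x <= c ^+ 2).
Proof. by move=> c0; rewrite -sqr_hnorm ler_pXn2r // nnegrE ?hnorm_ge0. Qed.

Lemma hnorm_lt_nsq x (c : R) : 0 <= c -> (hnorm ip x < c) = (nsq x < c ^+ 2).
Proof. by move=> c0; rewrite -sqr_hnorm ltr_pXn2r // nnegrE ?hnorm_ge0. Qed.

Lemma hnorm1P x : hnorm ip x = 1 <-> nsq x = 1.
Proof.
split=> h; first by rewrite -sqr_hnorm h expr1n.
by rewrite /hnorm -/(nsq x) h sqrtr1.
Qed.

Lemma hnormN x : hnorm ip (- x) = hnorm ip x.
Proof. by rewrite /hnorm -!/(nsq _) nsqN. Qed.

Lemma hnormC x y : hnorm ip (x - y) = hnorm ip (y - x).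
Proof. by rewrite -hnormN opprB. Qed.

Lemma hnorm0 : hnorm ip 0 = 0.
Proof. by rewrite /hnorm -/(nsq 0) nsq0 sqrtr0. Qed.

Lemma hnormZ a x : hnorm ip (a *: x) = Num.sqrt (cnsq a) * hnorm ip x.
Proof. by rewrite /hnorm -!/(nsq _) nsqZ sqrtrM // cnsq_ge0. Qed.

Lemma hnorm_eq0 x : hnorm ip x = 0 -> x = 0.
Proof. by move=> h; apply: nsq_eq0; rewrite -sqr_hnorm h expr0n. Qed.

Lemma norm_Re_ip_le x y : `|complex.Re (ip x y)| <= hnorm ip x * hnorm ip y.
Proof.
rewrite -(ler_pXn2r (n := 2)) // ?nnegrE ?normr_ge0 ?mulr_ge0 ?hnorm_ge0 //.
rewrite real_normK ?num_real // exprMn !sqr_hnorm.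
exact: le_trans (sqr_Re_le_cnsq _) (cauchy_schwarz _ _).
Qed.

Lemma Re_ip_le x y : complex.Re (ip x y) <= hnorm ip x * hnorm ip y.
Proof. exact: ler_normlW (norm_Re_ip_le x y). Qed.

Lemma hnormD x y : hnorm ip (x + y) <= hnorm ip x + hnorm ip y.
Proof.
rewrite hnorm_le_nsq ?addr_ge0 ?hnorm_ge0 // nsqD sqrrD !sqr_hnorm.
have := Re_ip_le x y; lra.
Qed.

Lemma hnormB x y : hnorm ip x - hnorm ip y <= hnorm ip (x - y).
Proof. by rewrite lerBlDr; apply: le_trans (hnormD _ _); rewrite subrK. Qed.

Lemma exists_normalized x : x <> 0 -> exists2 r : R, r != 0 &
  nsq (real_complex R r *: x) = 1.
Proof.
move=> x0; have h0 : hnorm ip x != 0 by apply/eqP => /hnorm_eq0.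
exists (hnorm ip x)^-1; first by rewrite invr_eq0.
by rewrite nsqZ cnsq_real exprVn -sqr_hnorm mulVf // sqrf_eq0.
Qed.

(** The squared lengths [l] may vanish, so images of an orthonormal family under an operator with a
    kernel are covered. *)
Definition ortho_family (I : finType) (w : I -> V) (l : I -> R) :=
  forall i j, ip (w i) (w j) = if i == j then real_complex R (l i) else 0.

Definition orthonormal (I : finType) (w : I -> V) := ortho_family w (fun=> 1).

Lemma ip_ortho_sum (I : finType) (w : I -> V) l (c : I -> R[i]) j :
  ortho_family w l -> ip (\sum_i c i *: w i) (w j) = c j * real_complex R (l j).
Proof.
move=> wo; rewrite ip_suml (bigD1 j) //= big1 ?addr0 => [|i /negPf ij].
  by rewrite ipZl wo eqxx.
by rewrite ipZl wo ij mulr0.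
Qed.

Lemma nsq_ortho_sum (I : finType) (w : I -> V) l (c : I -> R[i]) :
  ortho_family w l -> nsq (\sum_i c i *: w i) = \sum_i cnsq (c i) * l i.
Proof.
move=> wo; rewrite /nsq ip_sumr Re_sum; apply: eq_bigr => j _.
by rewrite ipZr (ip_ortho_sum _ _ wo) mulrA (mulrC (conjc _)) mulcJ -rmorphM.
Qed.

Lemma ip_orthonormal_sum (I : finType) (w : I -> V) (c : I -> R[i]) j :
  orthonormal w -> ip (\sum_i c i *: w i) (w j) = c j.
Proof. by move=> wo; rewrite (ip_ortho_sum _ _ wo) mulr1. Qed.

Lemma nsq_orthonormal_sum (I : finType) (w : I -> V) (c : I -> R[i]) :
  orthonormal w -> nsq (\sum_i c i *: w i) = \sum_i cnsq (c i).
Proof.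
by move=> wo; rewrite (nsq_ortho_sum _ wo); apply: eq_bigr => i _; rewrite mulr1.
Qed.

Lemma orthonormal_residual (I : finType) (w : I -> V) x j : orthonormal w ->
  ip (x - \sum_i ip x (w i) *: w i) (w j) = 0.
Proof. by move=> wo; rewrite ipBl ip_orthonormal_sum // subrr. Qed.

(** * Projection on a closed subspace *)

Lemma inv_succ_small (e : R) : 0 < e ->
  exists N : nat, forall n, (N <= n)%N -> n.+1%:R^-1 < e.
Proof.
move=> e0; exists (Num.bound e^-1) => n Nn.
have ie0 : 0 <= e^-1 by rewrite invr_ge0 ltW.
rewrite -[e]invrK ltf_pV2 ?posrE ?invr_gt0 //.
apply: lt_le_trans (archi_boundP ie0) _.
by rewrite ler_nat ltnW.
Qed.

Definition subspace (K : set V) :=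
  K 0 /\ forall a x y, K x -> K y -> K (a *: x + y).

Lemma closed_subspaceW K : closed_subspace ip K -> subspace K.
Proof. by case. Qed.

Lemma subspaceZ K a x : subspace K -> K x -> K (a *: x).
Proof. by move=> [K0 KL] Kx; rewrite -[_ *: _]addr0; apply: KL. Qed.

Lemma subspaceD K x y : subspace K -> K x -> K y -> K (x + y).
Proof. by move=> [K0 KL] Kx Ky; rewrite -[x]scale1r; apply: KL. Qed.

Lemma subspaceB K x y : subspace K -> K x -> K y -> K (x - y).
Proof.
by move=> Ks Kx Ky; apply: subspaceD => //; rewrite -scaleN1r; apply: subspaceZ.
Qed.

Lemma subspace_sum K (I : finType) (F : I -> V) :
  subspace K -> (forall i, K (F i)) -> K (\sum_i F i).
Proof.
move=> Ks KF; elim/big_ind: _ => // [|x y]; first by case: Ks.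
exact: subspaceD.
Qed.

(* Perturbing by [t <z, y> y] with [t = 1 / (|y|^2 + 1)]. *)
Lemma closest_point_ortho (N : set V) z : subspace N ->
  (forall y, N y -> nsq z <= nsq (z - y)) -> forall y, N y -> ip z y = 0.
Proof.
move=> Ns zmin y Ny; apply: cnsq_eq0; apply/eqP; rewrite eq_le cnsq_ge0 andbT.
have q0 : 0 < nsq y + 1 by rewrite ltr_wpDl ?nsq_ge0.
pose t := (nsq y + 1)^-1; have t0 : 0 < t by rewrite invr_gt0.
have := zmin _ (subspaceZ (real_complex R t * ip z y) Ns Ny).
rewrite nsqB nsqZ ipZr conjcM conjc_real -mulrA Re_real_mul (mulrC (conjc _)) Re_mulJ.
have -> : cnsq (real_complex R t * ip z y) = t ^+ 2 * cnsq (ip z y).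
  by case: (ip z y) => u v; rewrite /cnsq /=; ring.
rewrite -addrA lerDl => h.
have tq : t * nsq y = 1 - t by apply: (mulIf (lt0r_neq0 q0)); rewrite /t; field; exact: lt0r_neq0.
have {}h : 0 <= t * (- (1 + t) * cnsq (ip z y)).
  move: h; congr (_ <= _); rewrite expr2.
  by rewrite -mulrA (mulrAC t) tq; ring.
have t1 : 0 < 1 + t by rewrite addr_gt0.
by move: h; rewrite (pmulr_rge0 _ t0) mulNr oppr_ge0 (pmulr_rle0 _ t1).
Qed.

(** A sequence in [N] minimizing the distance to [x] is Cauchy by the parallelogram law; its limit
    is a closest point, and closest points have orthogonal residuals. *)
Lemma projection (N : set V) x : complete ip -> closed_subspace ip N ->
  exists2 p, N p & forall y, N y -> ip (x - p) y = 0.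
Proof.
move=> cV cN; have Ns := closed_subspaceW cN; case: (cN) => N0 _ Ncl.
pose D : set R := fun r => exists2 y, N y & r = nsq (x - y).
have Dlb y : N y -> inf D <= nsq (x - y).
  move=> Ny; apply: ge_inf; last by exists y.
  by exists 0 => _ [z _ ->]; apply: nsq_ge0.
have Dinf : has_inf D.
  split; first by exists (nsq (x - 0)); exists 0.
  by exists 0 => _ [z _ ->]; apply: nsq_ge0.
have d0 : 0 <= inf D.
  by apply: lb_le_inf; [case: Dinf|move=> _ [z _ ->]; apply: nsq_ge0].
have /choice[u uP] : forall n : nat, exists y, N y /\ nsq (x - y) < inf D + n.+1%:R^-1.
  move=> n; have n0 : 0 < n.+1%:R^-1 :> R by rewrite invr_gt0 ltr0n.
  by have [_ [y Ny ->] h] := inf_adherent n0 Dinf; exists y.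
have ucauchy : cauchy_seq ip u.
  (* The midpoint of [u m] and [u n] lies in [N], so the parallelogram law leaves [|u m - u n|^2 < 2
     / (m + 1) + 2 / (n + 1)], which is below [e ^+ 2] once each inverse is below [e ^+ 2 / 4]. *)
  move=> e e0; have e4 : 0 < e ^+ 2 / 4 by rewrite divr_gt0 // exprn_gt0.
  have [M MP] := inv_succ_small e4; exists M => m n Mm Mn.
  rewrite hnorm_lt_nsq ?(ltW e0) //.
  have := parallelogram (x - u n) (x - u m).
  have -> : x - u n - (x - u m) = u m - u n.
    by rewrite opprB addrC addrA subrK.
  have -> : x - u n + (x - u m) =
      real_complex R 2 *: (x - real_complex R 2^-1 *: (u n + u m)).
    rewrite scalerBr scalerA -rmorphM mulfV ?pnatr_eq0 // scale1r rmorphMn /=.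
    by rewrite rmorph1 scaler_nat mulr2n opprD addrACA.
  rewrite nsqZ cnsq_real.
  have := Dlb _ (subspaceZ (real_complex R 2^-1) Ns (subspaceD Ns (proj1 (uP n)) (proj1 (uP m)))).
  have := proj2 (uP m); have := proj2 (uP n); have := MP _ Mm; have := MP _ Mn.
  rewrite (_ : 2 ^+ 2 = 4); last by ring.
  move: (n.+1%:R^-1) (m.+1%:R^-1) (e ^+ 2) (nsq _) (nsq _) (nsq _) (nsq _) (inf D).
  by move=> *; lra.
have [p up] := cV _ ucauchy.
have Np : N p by apply: Ncl up => n; case: (uP n).
exists p => //; apply: closest_point_ortho => // y Ny.
rewrite -addrA -opprD; apply: le_trans (Dlb _ (subspaceD Ns Np Ny)).
have sd0 : 0 <= Num.sqrt (inf D) by apply: sqrtr_ge0.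
rewrite -[leRHS]sqr_sqrtr // -hnorm_le_nsq //.
suff sup_e (e : R) : 0 < e -> hnorm ip (x - p) <= Num.sqrt (inf D) + e.
  by apply/ler_addgt0Pr => e; apply: sup_e.
move=> e0.
have e2 : 0 < e / 2 by rewrite divr_gt0.
have [M1 M1P] := up _ e2.
(* An excess below [(e / 2) ^+ 2] in the squared distance costs at most [e / 2] in the distance,
   since the cross term of [(sqrt (inf D) + e / 2)^2] is nonnegative. *)
have [M2 M2P] := inv_succ_small (exprn_gt0 2 e2).
pose n := maxn M1 M2.
have -> : x - p = (x - u n) + (u n - p) by rewrite addrA subrK.
apply: le_trans (hnormD _ _) _.
have h1 := M1P n (leq_maxl _ _).
suff : hnorm ip (x - u n) <= Num.sqrt (inf D) + e / 2.
  by move=> h2; rewrite [e]splitr addrA; apply: lerD h2 (ltW h1).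
rewrite hnorm_le_nsq ?addr_ge0 ?(ltW e2) // sqrrD sqr_sqrtr //.
have := proj2 (uP n); have := M2P n (leq_maxr _ _).
have := mulr_ge0 sd0 (ltW e2).
move: (n.+1%:R^-1) (_ * _) (_ ^+ 2) (nsq _) (inf D) => *; lra.
Qed.

(** * Orthonormal bases of finite-dimensional subspaces *)

(* [L] need not be linear: for a choice of coordinates of [F x] on a spanning
   family that is not free, this is all one has, and it suffices for a rank
   bound. *)
Definition lin_reflecting (K : set V) k (L : V -> 'rV[R[i]]_k) :=
  forall m (w : 'I_m -> V) (c : 'I_m -> R[i]), (forall i, K (w i)) ->
    \sum_i c i *: L (w i) = 0 -> \sum_i c i *: w i = 0.

(** A linear relation among the rows [L (w i)] is reflected to one among the [w i], where pairing
    with [w j] kills each coefficient; so [m] independent rows fit in dimension [k]. *)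
Lemma orthonormal_card_le (K : set V) k (L : V -> 'rV[R[i]]_k) m (w : 'I_m -> V) :
  lin_reflecting K L -> orthonormal w -> (forall i, K (w i)) -> (m <= k)%N.
Proof.
move=> LP wo Kw; pose A := \matrix_i L (w i).
suff : row_free A by rewrite /row_free => /eqP <-; apply: rank_leq_col.
apply: inj_row_free => v; rewrite mulmx_sum_row => vA.
have /(LP _ _ _ Kw) h : \sum_i v 0 i *: L (w i) = 0.
  by rewrite -[RHS]vA; apply: eq_bigr => i _; rewrite rowK.
apply/rowP => j; rewrite mxE -(ip_orthonormal_sum (fun i => v 0 i) j wo) h.
exact: ip0l.
Qed.

Lemma orthonormal_extend m (w : 'I_m -> V) g : orthonormal w -> nsq g = 1 ->
  (forall i, ip g (w i) = 0) ->
  orthonormal (fun i : 'I_m.+1 => oapp w g (unlift ord0 i)).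
Proof.
move=> wo g1 gw i j.
case: (unliftP ord0 i) => [i'|] ->; case: (unliftP ord0 j) => [j'|] -> /=.
- by rewrite wo (inj_eq lift_inj).
- by rewrite ipC gw conjc0.
- by rewrite gw.
- by rewrite ipxx g1.
Qed.

(** The rank bound allows a largest orthonormal family in [K]; a nonzero residual of some [x] would,
    once normalized, enlarge it. *)
Lemma exists_onb (K : set V) k (L : V -> 'rV[R[i]]_k) :
  subspace K -> lin_reflecting K L ->
  exists m (w : 'I_m -> V), [/\ orthonormal w, forall i, K (w i) &
    forall x, K x -> x = \sum_i ip x (w i) *: w i].
Proof.
move=> Ks LP.
pose P m := `[< exists w : 'I_m -> V, orthonormal w /\ forall i, K (w i) >].
have P0 : exists m, P m by exists 0%N; apply/asboolP; exists (fun=> 0); split=> [] [].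
have Pk m : P m -> (m <= k)%N.
  by move=> /asboolP[w [wo Kw]]; apply: (orthonormal_card_le LP wo Kw).
case: (ex_maxnP P0 Pk) => m /asboolP[w [wo Kw]] mmax.
exists m, w; split=> // x Kx; apply/eqP; rewrite -subr_eq0; apply/eqP.
apply: contrapT => r0; have [r _ r1] := exists_normalized r0.
set g := (X in nsq X) in r1.
have gw j : ip g (w j) = 0 by rewrite ipZl orthonormal_residual ?mulr0.
have Kg : K g.
  apply: subspaceZ => //; apply: subspaceB => //.
  by apply: subspace_sum => // j; apply: subspaceZ.
have /mmax : P m.+1; last by rewrite ltnn.
apply/asboolP; exists (fun i : 'I_m.+1 => oapp w g (unlift ord0 i)).
by split=> [|i]; [exact: orthonormal_extend|case: (unlift ord0 i)].
Qed.

Lemma ip_sum_sum m n (w : 'I_m -> V) (w' : 'I_n -> V)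
    (a : 'I_m -> R[i]) (b : 'I_n -> R[i]) :
  ip (\sum_i a i *: w i) (\sum_j b j *: w' j) =
  \sum_j (\sum_i a i * ip (w i) (w' j)) * conjc (b j).
Proof.
rewrite ip_sumr; apply: eq_bigr => j _; rewrite ipZr mulrC ip_suml.
by congr (_ * _); apply: eq_bigr => i _; rewrite ipZl.
Qed.

(* The new basis diagonalizes the hermitian matrix [<T w_i, T w_j>]. *)
Lemma singular_value_basis (T : {linear V -> V}) m (w : 'I_m -> V) : orthonormal w ->
  exists (u : 'I_m -> V) (P : 'M[R[i]]_m), [/\ orthonormal u,
    ortho_family (T \o u) (nsq \o T \o u),
    forall i, u i = \sum_j P i j *: w j &
    forall x, x = \sum_i ip x (w i) *: w i -> x = \sum_i ip x (u i) *: u i].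
Proof.
move=> wo; pose A : 'M[R[i]]_m := \matrix_(i, j) ip (T (w i)) (T (w j)).
have Anormal : A \is normalmx.
  apply: hermitian_normalmx; apply/is_hermitianmxP.
  by apply/matrixP => i j; rewrite expr0 scale1r !mxE ipC.
pose P := spectralmx A; pose u i := \sum_j P i j *: w j.
have Pu : P \is unitarymx by apply: spectral_unitarymx.
have PPt : P *m (P ^t* )%sesqui = 1%:M by apply/unitarymxP.
have uo : orthonormal u.
  move=> i j; rewrite ip_sum_sum.
  have /matrixP/(_ i j) := PPt; rewrite !mxE => PPij.
  transitivity ((i == j)%:R : R[i]); last by case: eqP.
  rewrite -PPij; apply: eq_bigr => k _; rewrite !mxE; congr (_ * _).
  rewrite (bigD1 k) //= wo eqxx mulr1 big1 ?addr0 // => l /negPf lk.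
  by rewrite wo lk mulr0.
exists u, P; split=> // [i j|x xE].
  have [->|/negPf ij] /= := eqVneq i j; first exact: ipxx.
  rewrite /u !linear_sum.
  under eq_bigr do rewrite linearZ /=.
  under [X in ip _ X]eq_bigr do rewrite linearZ /=.
  rewrite ip_sum_sum.
  (* Off-diagonal entries of this diagonal matrix are the inner products of the images of distinct
     [u i]. *)
  have PAP : P *m A *m (P ^t* )%sesqui = diag_mx (spectral_diag A).
    have -> : P *m A = diag_mx (spectral_diag A) *m P.
      have /orthomx_spectralP AE := Anormal; rewrite {1}AE -/P !mulmxA.
      by rewrite mulmxV ?mul1mx // spectral_unit.
    by rewrite -mulmxA PPt mulmx1.
  have /matrixP/(_ i j) := PAP; rewrite !mxE ij mulr0n => PAPij; rewrite -[RHS]PAPij.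
    apply: eq_bigr => k _; rewrite !mxE; congr (_ * _).
  by apply: eq_bigr => l _; rewrite !mxE.
have PtP : (P ^t* )%sesqui *m P = 1%:M by apply: mulmx1C.
(* Unitarity of [P] inverts the change of basis, so [u] spans whatever [w] spans. *)
have wE j : w j = \sum_i conjc (P i j) *: u i.
  under eq_bigr do rewrite scaler_sumr.
  rewrite exchange_big /= (bigD1 j) //= [X in _ + X]big1 ?addr0 => [|k kj].
    under eq_bigr do rewrite scalerA.
    rewrite -scaler_suml; have /matrixP/(_ j j) := PtP.
    rewrite !mxE eqxx => PPj; rewrite -[LHS]scale1r; congr (_ *: _).
    by rewrite -[LHS]PPj; apply: eq_bigr => i _; rewrite !mxE.
  under eq_bigr do rewrite scalerA.
  rewrite -scaler_suml; have /matrixP/(_ j k) := PtP.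
  rewrite !mxE eq_sym (negPf kj) => PPj.
  suff -> : \sum_i conjc (P i j) * P i k = 0 by rewrite scale0r.
  by rewrite -[RHS]PPj; apply: eq_bigr => i _; rewrite !mxE.
have [c xc] : exists c : 'I_m -> R[i], x = \sum_i c i *: u i.
  exists (fun i => \sum_j ip x (w j) * conjc (P i j)).
  rewrite {1}xE; under eq_bigr do rewrite [X in _ *: X]wE scaler_sumr.
  rewrite exchange_big /=; apply: eq_bigr => i _.
  by rewrite scaler_suml; apply: eq_bigr => j _; rewrite scalerA.
rewrite {1}xc; apply: eq_bigr => i _.
by rewrite xc ip_orthonormal_sum.
Qed.

(** * Scalar plus finite rank operators *)

(** Trades the supremum of norms for a comparison of squared norms, which add along orthogonal
    decompositions. *)
Lemma norm_attaining_max M (T : V -> V) x : M x -> nsq x = 1 ->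
  (forall y, M y -> nsq y = 1 -> nsq (T y) <= nsq (T x)) -> norm_attaining_on ip M T.
Proof.
move=> Mx x1 xmax; exists x; split=> //; first exact/hnorm1P.
have xub : ubound [set r | exists x, [/\ M x, hnorm ip x = 1 & r = hnorm ip (T x)]]
    (hnorm ip (T x)).
  by move=> _ [y [My /hnorm1P y1 ->]]; rewrite hnorm_le; apply: xmax.
apply/eqP; rewrite eq_le; apply/andP; split.
  apply: ub_le_sup; first by exists (hnorm ip (T x)).
  by exists x; split=> //; exact/hnorm1P.
apply: ge_sup => //; exists (hnorm ip (T x)), x.
by split=> //; exact/hnorm1P.
Qed.

Lemma min_attaining_min M (T : V -> V) x : M x -> nsq x = 1 ->
  (forall y, M y -> nsq y = 1 -> nsq (T x) <= nsq (T y)) -> min_attaining_on ip M T.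
Proof.
move=> Mx x1 xmin; exists x; split=> //; first exact/hnorm1P.
have xlb : lbound [set r | exists x, [/\ M x, hnorm ip x = 1 & r = hnorm ip (T x)]]
    (hnorm ip (T x)).
  by move=> _ [y [My /hnorm1P y1 ->]]; rewrite hnorm_le; apply: xmin.
apply/eqP; rewrite eq_le; apply/andP; split.
  apply: lb_le_inf => //; exists (hnorm ip (T x)), x.
  by split=> //; exact/hnorm1P.
apply: ge_inf; first by exists (hnorm ip (T x)).
by exists x; split=> //; exact/hnorm1P.
Qed.

(** Boundedness makes [sup] a true upper bound rather than the default value of an unbounded set. *)
Lemma norm_attaining_maxP M (T : V -> V) : bounded ip T -> norm_attaining_on ip M T ->
  exists x, [/\ M x, nsq x = 1 &
    forall y, M y -> nsq y = 1 -> nsq (T y) <= nsq (T x)].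
Proof.
move=> [C TC] [x [Mx /hnorm1P x1 xsup]]; exists x; split=> // y My y1.
rewrite -hnorm_le xsup; apply: ub_le_sup; last by exists y; split=> //; exact/hnorm1P.
by exists C => _ [z [_ z1 ->]]; rewrite -[C]mulr1 -z1.
Qed.

Lemma min_attaining_minP M (T : V -> V) : min_attaining_on ip M T ->
  exists x, [/\ M x, nsq x = 1 &
    forall y, M y -> nsq y = 1 -> nsq (T x) <= nsq (T y)].
Proof.
move=> [x [Mx /hnorm1P x1 xinf]]; exists x; split=> // y My y1.
rewrite -hnorm_le xinf; apply: ge_inf; last by exists y; split=> //; exact/hnorm1P.
by exists 0 => _ [z [_ z1 ->]]; apply: hnorm_ge0.
Qed.

(** Serves as the passage to the limit in the approximation arguments below. *)
Lemma le0_of_le_small (r C : R) : (forall e, 0 < e -> r <= C * e) -> r <= 0.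
Proof.
move=> h; rewrite leNgt; apply/negP => r0.
have C1 : 0 < `|C| + 1 by rewrite ltr_wpDl.
(* For this [e], [C * e] is at most [r / 2]. *)
have e0 : 0 < r / (`|C| + 1) / 2 by rewrite !divr_gt0.
have := h _ e0; apply/negP; rewrite -ltNge.
apply: le_lt_trans (_ : _ <= (`|C| + 1) * (r / (`|C| + 1) / 2)) _.
  rewrite ler_pM2r //; apply: le_trans (ler_norm _) _; lra.
rewrite mulrA (mulrC (`|C| + 1)) mulfVK ?gt_eqF //; lra.
Qed.

Lemma bounded_ge0 (T : V -> V) : bounded ip T ->
  exists2 C : R, 0 <= C & forall x, hnorm ip (T x) <= C * hnorm ip x.
Proof.
move=> [C TC]; exists `|C| => // x; apply: le_trans (TC x) _.
by rewrite ler_wpM2r ?hnorm_ge0 // ler_norm.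
Qed.

Lemma kernel_lim (F : {linear V -> V}) (u : nat -> V) l : bounded ip F ->
  (forall n, F (u n) = 0) -> converges_to ip u l -> F l = 0.
Proof.
move=> /bounded_ge0[C C0 FC] Fu ul; apply: hnorm_eq0; apply/eqP.
rewrite eq_le hnorm_ge0 andbT; apply: (@le0_of_le_small _ C) => e e0.
have [n /(_ n (leqnn n)) ne] := ul _ e0.
rewrite -[F l]subr0 -(Fu n) -linearB; apply: le_trans (FC _) _.
by rewrite ler_wpM2l // hnormC ltW.
Qed.

Lemma ortho_lim (u : nat -> V) l y : (forall n, ip (u n) y = 0) ->
  converges_to ip u l -> ip l y = 0.
Proof.
move=> uy ul; apply: cnsq_eq0; apply/eqP; rewrite eq_le cnsq_ge0 andbT.
(* Pairing with [z] turns [|<l, y>|^2] into the real part of [<l - u n, z>], which Cauchy-Schwarz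
   makes small. *)
pose z := ip l y *: y.
apply: (@le0_of_le_small _ (hnorm ip z)) => e e0.
have [n /(_ n (leqnn n)) ne] := ul _ e0.
have -> : cnsq (ip l y) = complex.Re (ip (l - u n) z).
  by rewrite ipBl !ipZr uy mulr0 subr0 mulrC Re_mulJ.
apply: le_trans (Re_ip_le _ _) _.
by rewrite mulrC ler_wpM2l ?hnorm_ge0 // hnormC ltW.
Qed.

Lemma sum_option (I : finType) (f : option I -> R) :
  \sum_j f j = f None + \sum_i f (Some i).
Proof.
rewrite (bigD1 None) //= (reindex_omap Some id) /=; last by case.
by congr (_ + _); apply: eq_bigl => i; rewrite eqxx.
Qed.

(** A weighted mean lies between the extreme values carrying weight. The predicate [A] marks the
    values known to be attained, outside of which the weights vanish. *)
Lemma convex_sum_extremal (J : finType) (A : pred J) (lam : J -> R) j0 : A j0 ->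
  exists j1 j2, [/\ A j1, A j2 &
    forall a : J -> R, (forall j, 0 <= a j) -> (forall j, ~~ A j -> a j = 0) ->
      \sum_j a j = 1 -> lam j1 <= \sum_j a j * lam j <= lam j2].
Proof.
move=> Aj0; case: (arg_minP lam Aj0) => j1 Aj1 min1.
case: (arg_maxP lam Aj0) => j2 Aj2 max2.
exists j1, j2; split=> // a a0 aA a1.
have aj j : A j \/ a j = 0 by case: (boolP (A j)) => [|/aA]; [left|right].
rewrite -[lam j1]mul1r -[lam j2]mul1r -a1 !mulr_suml.
apply/andP; split; apply: ler_sum => j _; case: (aj j) => [Aj|->].
- by rewrite ler_wpM2l // min1.
- by rewrite !mul0r.
- by rewrite ler_wpM2l //; apply: max2.
- by rewrite !mul0r.
Qed.

Lemma scalar_plus_finite_rank (T F : {linear V -> V}) c : complete ip ->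
  (forall x, T x = c *: x + F x) -> bounded ip F -> fin_dim (op_range F) ->
  forall M, closed_subspace ip M -> nonzero_set M ->
  norm_attaining_on ip M T /\ min_attaining_on ip M T.
Proof.
move=> cV TE Fb [n [v vP]] M Mcl [x0 [Mx0 x0n]].
have Ms := closed_subspaceW Mcl.
have /choice[k kP] : forall x, exists k : 'I_n -> R[i], F x = \sum_i k i *: v i.
  by move=> x; apply: vP; exists x.
(* On [N] the operator [T] is multiplication by [c]. If [z] is orthogonal to [p] in [N], then
   [T z = c z + F z] is orthogonal to [p], hence to [T p]. *)
pose N : set V := fun x => [/\ M x, F x = 0 & forall i, ip x (v i) = 0].
have Ncl : closed_subspace ip N.
  split; first by split=> [||i]; [case: Ms|rewrite linear0|rewrite ip0l].
    move=> a x y [Mx Fx vx] [My Fy vy]; split; first by case: Ms => _; apply.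
      by rewrite linearP Fx Fy scaler0 addr0.
    by move=> i; rewrite ip_lin vx vy mulr0 addr0.
  move=> u l uN ul; split.
  - by case: Mcl => _ _ /(_ u); apply=> // m; case: (uN m).
  - by apply: kernel_lim Fb _ ul => m; case: (uN m).
  - by move=> i; apply: ortho_lim ul => m; case: (uN m).
pose W : set V := fun x => M x /\ forall y, N y -> ip x y = 0.
have Ws : subspace W.
  split; first by split=> [|y _]; [case: Ms|rewrite ip0l].
  move=> a x y [Mx Nx] [My Ny]; split; first by case: Ms => _; apply.
  by move=> z Nz; rewrite ip_lin Nx // Ny // mulr0 addr0.
(* A vector of [W] on which these [2n] coordinates cancel also lies in [N], hence is orthogonal to
   itself. *)
pose L x := row_mx (\row_i k x i) (\row_i ip x (v i)).
have LP : lin_reflecting W L.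
  move=> m w b Ww L0; set y := \sum_i _.
  have Wy : W y by apply: subspace_sum => // i; apply: subspaceZ.
  apply: (nsq_eq0); rewrite /nsq (proj2 Wy) //; split; first by case: Wy.
    rewrite linear_sum; under eq_bigr do rewrite linearZ /= kP scaler_sumr.
    rewrite exchange_big big1 //= => j _.
    under eq_bigr do rewrite scalerA.
    rewrite -scaler_suml; have /rowP/(_ (lshift n j)) := L0.
    rewrite summxE mxE => L0j.
    suff -> : \sum_i b i * k (w i) j = 0 by rewrite scale0r.
    by rewrite -[RHS]L0j; apply: eq_bigr => i _; rewrite mxE row_mxEl mxE.
  move=> j; have /rowP/(_ (rshift n j)) := L0.
  rewrite summxE mxE => L0j; rewrite ip_suml -[RHS]L0j.
  by apply: eq_bigr => i _; rewrite ipZl mxE row_mxEr mxE.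
have [m [w [wo Ww wspan]]] := exists_onb Ws LP.
have [u [P [uo Tuo uw uspan]]] := singular_value_basis T wo.
have Wu i : W (u i).
  by rewrite uw; apply: subspace_sum => // j; apply: subspaceZ.
(* The index [None] stands for the [N] component, with value [|c|^2]. That value is attained on [N]
   only if [N] is nonzero, so [A] admits [None] just in that case. *)
pose Nnz := `[< exists x, N x /\ x <> 0 >].
pose A (j : option 'I_m) := if j is Some _ then true else Nnz.
pose lam (j : option 'I_m) := if j is Some i then nsq (T (u i)) else cnsq c.
have dec x : M x -> exists a : option 'I_m -> R, [/\ forall j, 0 <= a j,
    forall j, ~~ A j -> a j = 0, nsq x = \sum_j a j & nsq (T x) = \sum_j a j * lam j].
  move=> Mx; have [p Np pP] := projection x cV Ncl.
  have Wxp : W (x - p).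
    by split=> //; apply: subspaceB => //; case: Np.
  have := uspan _ (wspan _ Wxp); set d := fun i => ip (x - p) (u i) => xpE.
  exists (fun j => if j is Some i then cnsq (d i) else nsq p); split.
  - by move=> [i|]; rewrite ?cnsq_ge0 ?nsq_ge0.
  - move=> [i|] //= /asboolPn h; suff -> : p = 0 by rewrite nsq0.
    by apply: contrapT => p0; apply: h; exists p.
  - rewrite -{1}(subrK p x) pythagoras ?pP // sum_option /=.
    by rewrite {1}xpE (nsq_orthonormal_sum _ uo) addrC.
  - rewrite -{1}(subrK p x) linearD pythagoras; last first.
      rewrite !TE; have [_ -> pv] := Np; rewrite addr0 ipZr ipDl ipZl pP // mulr0 add0r.
      rewrite ipC kP ip_sumr big1 ?conjc0 ?mulr0 // => i _.
      by rewrite ipZr pv mulr0.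
    rewrite sum_option /= addrC TE; have [_ -> _] := Np.
    rewrite addr0 nsqZ mulrC; congr (_ + _).
    rewrite {1}xpE linear_sum; under [X in nsq X]eq_bigr do rewrite linearZ /=.
    by rewrite (nsq_ortho_sum _ Tuo).
have att j : A j -> exists x, [/\ M x, nsq x = 1 & nsq (T x) = lam j].
  case: j => [i _|/asboolP[x [[Mx Fx vx] xn]]] /=.
    by exists (u i); split=> //; [case: (Wu i)|rewrite /nsq uo eqxx].
  have [r _ r1] := exists_normalized xn; exists (real_complex R r *: x).
  split=> //; first exact: subspaceZ.
  have -> : T (real_complex R r *: x) = c *: (real_complex R r *: x).
    by rewrite TE [F _]linearZ /= Fx scaler0 addr0.
  by rewrite nsqZ r1 mulr1.
(* Were no index admissible, all weights of the nonzero vector [x0] would vanish. *)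
have [j0 Aj0] : exists j, A j.
  have [a [_ aA x0E _]] := dec _ Mx0; apply: contrapT => /forallNP nA.
  have := nsq_gt0 x0n; rewrite x0E big1 ?ltxx // => j _; apply: aA.
  exact/negP.
have [j1 [j2 [Aj1 Aj2 jP]]] := convex_sum_extremal lam Aj0.
have [x1 [Mx1 x11 x1E]] := att _ Aj1; have [x2 [Mx2 x21 x2E]] := att _ Aj2.
have bnd y : M y -> nsq y = 1 -> nsq (T x1) <= nsq (T y) <= nsq (T x2).
  move=> My y1; have [a [a0 aA yE TyE]] := dec _ My.
  by rewrite TyE x1E x2E; apply: jP => //; rewrite -yE.
split; [apply: (norm_attaining_max Mx2)|apply: (min_attaining_min Mx1)] => // y My y1.
  by case/andP: (bnd _ My y1).
by case/andP: (bnd _ My y1).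
Qed.

(** * Orthonormal sequences diagonalizing an operator *)

(** The conditions amount to finitely many linear equations. If no unit vector of [K] solved them,
    the inner products against [s] and its image would be reflecting coordinates on [K], making [K]
    finite dimensional. *)
Lemma not_fin_dim_ortho (K : set V) (S : {linear V -> V}) (s : seq V) :
  subspace K -> ~ fin_dim K ->
  exists g, [/\ K g, nsq g = 1 &
    forall y, y \in s -> ip g y = 0 /\ ip (S g) (S y) = 0].
Proof.
move=> Ks Kinf; apply: contrapT => noneg; apply: Kinf.
pose y (i : 'I_(size s)) := s`_i.
pose L x := row_mx (\row_i ip x (y i)) (\row_i ip (S x) (S (y i))).
have LP : lin_reflecting K L.
  move=> m w b Kw L0; set x := \sum_i _.
  have Kx : K x by apply: subspace_sum => // i; apply: subspaceZ.
  apply: contrapT => x0; have [r _ r1] := exists_normalized x0.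
  apply: noneg; exists (real_complex R r *: x); split=> // [|z zs].
    exact: subspaceZ.
  have iz : (index z s < size s)%N by rewrite index_mem.
  have zE : z = y (Ordinal iz) by rewrite /y nth_index.
  split; rewrite ?[S _]linearZ ipZl zE; move: (Ordinal iz) => j.
    have /rowP/(_ (lshift _ j)) := L0; rewrite summxE mxE => L0j.
    suff -> : ip x (y j) = 0 by rewrite mulr0.
    rewrite ip_suml -[RHS]L0j.
    by apply: eq_bigr => i _; rewrite ipZl mxE row_mxEl mxE.
  have /rowP/(_ (rshift _ j)) := L0; rewrite summxE mxE => L0j.
  suff -> : ip (S x) (S (y j)) = 0 by rewrite mulr0.
  rewrite linear_sum ip_suml -[RHS]L0j.
  by apply: eq_bigr => i _; rewrite linearZ /= ipZl mxE row_mxEr mxE.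
have [m [w [_ _ wspan]]] := exists_onb Ks LP.
by exists m, w => x Kx; exists (fun i => ip x (w i)); apply: wspan.
Qed.

Section GapBetweenInfiniteDimensionalSubspaces.
Variables (S : {linear V -> V}) (K1 K2 : set V) (a b : R).
Hypotheses (K1s : subspace K1) (K2s : subspace K2).
Hypotheses (K1inf : ~ fin_dim K1) (K2inf : ~ fin_dim K2).
Hypotheses (K1S : forall x, K1 x -> nsq x = 1 -> nsq (S x) <= a).
Hypotheses (K2S : forall x, K2 x -> nsq x = 1 -> b <= nsq (S x)).
Hypothesis ab : a < b.

(** Take [e] in [K1] and [f] in [K2] orthogonal to each other and to [s], with the same for their
    images. Then [sqrt t f + sqrt (1 - t) e] has squared image norm [t B + (1 - t) A], which sweeps
    an interval containing [[a, b]]. *)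
Lemma exists_unit_with_image_norm (s : seq V) (lam : R) : a <= lam <= b ->
  exists g, [/\ nsq g = 1, nsq (S g) = lam &
    forall y, y \in s -> ip g y = 0 /\ ip (S g) (S y) = 0].
Proof.
case/andP => alam lamb.
have [e [K1e e1 es]] := not_fin_dim_ortho S s K1s K1inf.
have [f [K2f f1 fs]] := not_fin_dim_ortho S (e :: s) K2s K2inf.
have [fe Sfe] := fs e (mem_head _ _).
have Ae := K1S K1e e1; have Bf := K2S K2f f1.
set A := nsq (S e) in Ae *; set B := nsq (S f) in Bf *.
have BA : 0 < B - A.
  by rewrite subr_gt0 (le_lt_trans Ae) // (lt_le_trans ab).
(* The solution of [t B + (1 - t) A = lam]; it lies in [[0, 1]] because
   [A <= a <= lam <= b <= B]. *)
pose t := (lam - A) / (B - A).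
have t0 : 0 <= t by rewrite divr_ge0 ?(ltW BA) // subr_ge0 (le_trans Ae).
have t1 : 0 <= 1 - t.
  by rewrite subr_ge0 ler_pdivrMr // mul1r lerB // (le_trans lamb).
exists (real_complex R (Num.sqrt t) *: f + real_complex R (Num.sqrt (1 - t)) *: e).
split.
- rewrite pythagoras; last by rewrite ipZl ipZr fe !mulr0.
  by rewrite !nsqZ !cnsq_real !sqr_sqrtr // e1 f1; ring.
- rewrite linearD !linearZ /= pythagoras; last by rewrite ipZl ipZr Sfe !mulr0.
  rewrite !nsqZ !cnsq_real !sqr_sqrtr // -/A -/B /t; field.
  exact: lt0r_neq0.
- move=> y ys; have [ey Sey] := es y ys.
  have [|fy Sfy] := fs y; first by rewrite inE ys orbT.
  rewrite linearD !linearZ /= !ipDl !ipZl ey Sey fy Sfy.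
  by rewrite !mulr0 addr0.
Qed.

Lemma exists_diagonalizing_sequence (lam : nat -> R) : (forall n, a <= lam n <= b) ->
  exists g : nat -> V, [/\ forall n, nsq (g n) = 1, forall n, nsq (S (g n)) = lam n &
    forall m n, m != n -> ip (g m) (g n) = 0 /\ ip (S (g m)) (S (g n)) = 0].
Proof.
move=> lamP.
have /choice[next nextP] : forall p : nat * seq V, exists g, [/\ nsq g = 1,
    nsq (S g) = lam p.1 & forall y, y \in p.2 -> ip g y = 0 /\ ip (S g) (S y) = 0].
  by move=> p; apply: exists_unit_with_image_norm.
(* [h n] lists the first [n] vectors chosen, to which [next] makes the following one orthogonal,
   images included. *)
pose h := fix h n := if n is n'.+1 then next (n', h n') :: h n' else [::].
pose g n := next (n, h n).
have gh m n : (m < n)%N -> g m \in h n.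
  elim: n => // n IHn; rewrite ltnS leq_eqVlt => /predU1P[->|/IHn mn].
    exact: mem_head.
  by rewrite inE mn orbT.
exists g; split=> [n|n|m n].
- by case: (nextP (n, h n)).
- by case: (nextP (n, h n)).
have lt_case i j : (i < j)%N -> ip (g j) (g i) = 0 /\ ip (S (g j)) (S (g i)) = 0.
  by move=> /gh ij; case: (nextP (j, h j)) => _ _; apply.
rewrite neq_ltn => /orP[/lt_case[mn Smn]|/lt_case//].
by split; apply: ip_eq0C.
Qed.

End GapBetweenInfiniteDimensionalSubspaces.

(** * Fourier expansions along a diagonalizing sequence *)

Section ClosedSpanOfDiagonalizingSequence.
Variables (S : {linear V -> V}) (g : nat -> V) (lam : nat -> R).
Hypothesis Sb : bounded ip S.
Hypothesis g1 : forall n, nsq (g n) = 1.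
Hypothesis Sg : forall n, nsq (S (g n)) = lam n.
Hypothesis go : forall m n, m != n -> ip (g m) (g n) = 0 /\ ip (S (g m)) (S (g n)) = 0.

Definition partial_sum n x : V := \sum_(i < n) ip x (g i) *: g i.

Lemma partial_orthonormal n : orthonormal (fun i : 'I_n => g i).
Proof.
move=> i j; case: (eqVneq i j) => [->|ij]; first by rewrite ipxx g1.
by case: (go ij).
Qed.

Lemma partial_ortho_image n :
  ortho_family (fun i : 'I_n => S (g i)) (fun i : 'I_n => lam i).
Proof.
move=> i j; case: (eqVneq i j) => [->|ij]; first by rewrite ipxx Sg.
by case: (go ij).
Qed.

Lemma partial_sumD n c x y :
  partial_sum n (c *: x + y) = c *: partial_sum n x + partial_sum n y.
Proof.
rewrite /partial_sum scaler_sumr -big_split /=; apply: eq_bigr => i _.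
by rewrite ip_lin scalerDl scalerA.
Qed.

Lemma nsq_residual n x :
  nsq (x - partial_sum n x) = nsq x - \sum_(i < n) cnsq (ip x (g i)).
Proof.
have -> : nsq x = nsq (x - partial_sum n x) + nsq (partial_sum n x).
  rewrite -pythagoras ?subrK // /partial_sum ip_sumr big1 // => i _.
  by rewrite ipZr (orthonormal_residual x i (@partial_orthonormal n)) mulr0.
by rewrite (nsq_orthonormal_sum _ (@partial_orthonormal n)) addrK.
Qed.

Lemma hnorm_residual_mono m n x : (m <= n)%N ->
  hnorm ip (x - partial_sum n x) <= hnorm ip (x - partial_sum m x).
Proof.
move=> mn; rewrite hnorm_le !nsq_residual lerD2l lerN2.
rewrite -!(big_mkord xpredT (fun i => cnsq (ip x (g i)))).
rewrite (big_cat_nat (leq0n m) mn) /= lerDl.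
by apply: sumr_ge0 => i _; apply: cnsq_ge0.
Qed.

Lemma hnorm_residual_le n x : hnorm ip (x - partial_sum n x) <= hnorm ip x.
Proof.
apply: le_trans (hnorm_residual_mono x (leq0n n)) _.
by rewrite /partial_sum big_ord0 subr0.
Qed.

(** The closed span of [g], through Fourier partial sums. Residuals decrease with [n], so one good
    [n] for each [e] amounts to convergence. *)
Definition span_closure : set V :=
  fun x => forall e : R, 0 < e -> exists n, hnorm ip (x - partial_sum n x) < e.

Lemma span_closure_mem k : span_closure (g k).
Proof.
move=> e e0; exists k.+1; suff -> : partial_sum k.+1 (g k) = g k.
  by rewrite subrr hnorm0.
rewrite /partial_sum big_ord_recr /= big1 => [|i _].
  by rewrite add0r ipxx g1 scale1r.
by have [-> _] := go (negbT (gtn_eqF (ltn_ord i))); rewrite scale0r.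
Qed.

Lemma span_closure_closed : closed_subspace ip span_closure.
Proof.
split.
- by move=> e e0; exists 0%N; rewrite /partial_sum big_ord0 subr0 hnorm0.
- move=> c x y xM yM e e0; set s := Num.sqrt (cnsq c).
  have s1 : 0 < s + 1 by rewrite ltr_wpDl ?sqrtr_ge0.
  have e1 : 0 < e / (s + 1) by rewrite divr_gt0.
  have [m xm] := xM _ e1; have [n yn] := yM _ e1.
  exists (maxn m n); rewrite partial_sumD opprD addrACA -scalerBr.
  apply: le_lt_trans (hnormD _ _) _; rewrite hnormZ -/s.
  have xm' := le_lt_trans (hnorm_residual_mono x (leq_maxl m n)) xm.
  have yn' := le_lt_trans (hnorm_residual_mono y (leq_maxr m n)) yn.
  have -> : e = s * (e / (s + 1)) + e / (s + 1) by field; exact: lt0r_neq0.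
  apply: ler_ltD => //; apply: ler_wpM2l (ltW xm'); exact: sqrtr_ge0.
- move=> u l uM ul e e0; have e2 : 0 < e / 2 by rewrite divr_gt0.
  have [k /(_ k (leqnn k)) kl] := ul _ e2; have [n kn] := uM k _ e2.
  (* The residual is linear and norm-nonincreasing: that of [l] splits into that of [u k] and that
     of the small vector [l - u k]. *)
  exists n; have -> : l - partial_sum n l = (u k - partial_sum n (u k)) +
      ((l - u k) - partial_sum n (l - u k)).
    have -> : partial_sum n (l - u k) = partial_sum n l - partial_sum n (u k).
      by rewrite [l - _]addrC -scaleN1r partial_sumD scaleN1r addrC.
    by rewrite opprB addrACA [u k + _]addrC subrK addKr.
  apply: le_lt_trans (hnormD _ _) _; rewrite [e]splitr; apply: ltrD => //.
  by apply: le_lt_trans (hnorm_residual_le _ _) _; rewrite hnormC.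
Qed.

(* Continuity of the form [al * nsq x + be * nsq (S x)] transfers its
   diagonal expression from the partial sums to their limit. *)
Lemma diagonal_form_ge (al be : R) k x : (forall n, 0 <= al + be * lam n) ->
  span_closure x ->
  (al + be * lam k) * cnsq (ip x (g k)) <= al * nsq x + be * nsq (S x).
Proof.
move=> pos xM; have [C C0 SC] := bounded_ge0 Sb.
rewrite -subr_le0.
pose K := `|al| + `|be| * C ^+ 2.
(* With [d] the residual of [x], expanding the form at [x - d] gives the cross term twice and the
   form at [d] once. Each is at most [K |x| e], as [|d| <= |x|] and [|d| < e]. *)
apply: (@le0_of_le_small _ (3 * K * hnorm ip x)) => e e0.
have [n0 xn0] := xM _ e0; pose n := maxn n0 k.+1.
have := le_lt_trans (hnorm_residual_mono x (leq_maxl n0 k.+1)) xn0.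
have := hnorm_residual_le n x; rewrite -/n; set d := x - partial_sum n x => dx de.
have xdE : x - d = partial_sum n x by rewrite opprB addrC subrK.
have form_ge : (al + be * lam k) * cnsq (ip x (g k)) <=
    al * nsq (x - d) + be * nsq (S (x - d)).
  rewrite xdE linear_sum; under [X in _ + _ * nsq X]eq_bigr do rewrite linearZ /=.
  rewrite (nsq_orthonormal_sum _ (@partial_orthonormal n)).
  rewrite (nsq_ortho_sum _ (@partial_ortho_image n)) !mulr_sumr -big_split /=.
  have kn : (k < n)%N by rewrite leq_max ltnSn orbT.
  rewrite (bigD1 (Ordinal kn)) //= -[leLHS]addr0; apply: lerD.
    by rewrite le_eqVlt; apply/orP; left; apply/eqP; ring.
  apply: sumr_ge0 => i _.
  rewrite (_ : _ + _ = (al + be * lam i) * cnsq (ip x (g i))); last by ring.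
  by rewrite mulr_ge0 ?cnsq_ge0.
have form_bound y z : `|al * complex.Re (ip y z) + be * complex.Re (ip (S y) (S z))|
    <= K * (hnorm ip y * hnorm ip z).
  apply: le_trans (ler_normD _ _) _; rewrite !normrM mulrDl; apply: lerD.
    by rewrite ler_wpM2l // norm_Re_ip_le.
  rewrite -mulrA ler_wpM2l //; apply: le_trans (norm_Re_ip_le _ _) _.
  rewrite expr2 mulrACA; apply: ler_pM; rewrite ?hnorm_ge0 //.
have K0 : 0 <= K by rewrite addr_ge0 // mulr_ge0 // exprn_ge0.
have := ler_normlW (form_bound d d); have := form_bound x d.
rewrite ler_norml => /andP[form_xd _] form_dd.
have Kdd : K * (hnorm ip d * hnorm ip d) <= K * (hnorm ip x * e).
  by rewrite ler_wpM2l // ler_pM ?hnorm_ge0 // ltW.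
have Kxd : K * (hnorm ip x * hnorm ip d) <= K * (hnorm ip x * e).
  by rewrite ler_wpM2l // ler_wpM2l ?hnorm_ge0 // ltW.
move: form_ge; rewrite [S (x - d)]linearB (nsqB x d) (nsqB (S x)).
have -> : 3 * K * hnorm ip x * e = 3 * (K * (hnorm ip x * e)) by ring.
move: form_xd form_dd Kdd Kxd; rewrite -!/(nsq _).

move: (K * (hnorm ip d * hnorm ip d)) (K * (hnorm ip x * hnorm ip d)) (K * (hnorm ip x * e)).
move: (nsq _) (nsq _) (nsq _) (nsq _) (complex.Re _) (complex.Re _) (_ * cnsq _) => *.
lra.
Qed.

(** A vector of the closed span with all coefficients zero has zero partial sums, hence is zero. So
    some coefficient of [x] is nonzero, and its term alone bounds the form from below by a positive
    number. *)
Lemma diagonal_form_gt0 (al be : R) x : (forall n, 0 < al + be * lam n) ->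
  span_closure x -> x <> 0 -> 0 < al * nsq x + be * nsq (S x).
Proof.
move=> pos xM x0; have [k xk] : exists k, ip x (g k) <> 0.
  apply: contrapT => /forallNP xg; apply: x0; apply: hnorm_eq0; apply/eqP.
  rewrite eq_le hnorm_ge0 andbT; apply: (@le0_of_le_small _ 1) => e e0.
  have [n] := xM _ e0; rewrite /partial_sum big1 => [|i _].
    by rewrite subr0 mul1r => /ltW.
  by have /contrapT -> := xg i; rewrite scale0r.
apply: lt_le_trans (diagonal_form_ge k (fun n => ltW (pos n)) xM).
rewrite mulr_gt0 // lt_def cnsq_ge0 andbT; apply/eqP => /cnsq_eq0; exact: xk.
Qed.

End ClosedSpanOfDiagonalizingSequence.

(** * Closed subspaces on which the norm or the minimum modulus is not attained *)

Section AttainmentFailure.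
Variables (S : {linear V -> V}) (K1 K2 : set V) (a b : R).
Hypothesis Sb : bounded ip S.
Hypotheses (K1s : subspace K1) (K2s : subspace K2).
Hypotheses (K1inf : ~ fin_dim K1) (K2inf : ~ fin_dim K2).
Hypotheses (K1S : forall x, K1 x -> nsq x = 1 -> nsq (S x) <= a).
Hypotheses (K2S : forall x, K2 x -> nsq x = 1 -> b <= nsq (S x)).
Hypothesis ab : a < b.

(** Starting at [b - a] keeps [b - gap n] and [a + gap n] inside [[a, b]] from [n = 0] on. *)
Let gap (n : nat) : R := (b - a) / n.+1%:R.

Lemma gap_gt0 n : 0 < gap n.
Proof. by rewrite divr_gt0 ?subr_gt0. Qed.

Lemma gap_le n : gap n <= b - a.
Proof. by rewrite ler_pdivrMr // ler_peMr ?ler1n // subr_ge0 ltW. Qed.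

Lemma gap_small (e : R) : 0 < e -> exists n, gap n < e.
Proof.
have ba : 0 < b - a by rewrite subr_gt0.
move=> e0; have [N /(_ N (leqnn N)) Ne] := inv_succ_small (divr_gt0 e0 ba).
by exists N; rewrite /gap mulrC -ltr_pdivlMr.
Qed.

Lemma exists_not_norm_attaining : exists M, [/\ closed_subspace ip M, nonzero_set M &
  ~ norm_attaining_on ip M S].
Proof.
have lamP n : a <= b - gap n <= b.
  by rewrite lerBrDr -lerBrDl gap_le gerBl ltW ?gap_gt0.
have [g [g1 Sg go]] :=
  exists_diagonalizing_sequence K1s K2s K1inf K2inf K1S K2S ab lamP.
exists (span_closure g); split; first exact: span_closure_closed g1 go.
  exists (g 0%N); split; first exact: span_closure_mem g1 go 0%N.
  by move=> g0; have := g1 0%N; rewrite g0 nsq0 => /esym/eqP; rewrite oner_eq0.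
move=> /(norm_attaining_maxP Sb)[x [Mx x1 xmax]].
have x0 : x <> 0 by move=> x0; move: x1; rewrite x0 nsq0 => /esym/eqP; rewrite oner_eq0.
(* With [al = b] and [be = -1] the diagonal coefficients are [gap n], so [|S x|^2 < b], and some
   [g n] beats the supposed maximizer. *)
have pos n : 0 < b + -1 * (b - gap n) by rewrite mulN1r opprB addrCA subrr addr0 gap_gt0.
have := diagonal_form_gt0 Sb g1 Sg go pos Mx x0.
rewrite x1 mulr1 mulN1r => /gap_small[n nlt].
have := xmax _ (span_closure_mem g1 go n) (g1 n); rewrite Sg.
by rewrite lerBlDr -lerBlDl leNgt nlt.
Qed.

Lemma exists_not_min_attaining : exists M, [/\ closed_subspace ip M, nonzero_set M &
  ~ min_attaining_on ip M S].
Proof.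
have lamP n : a <= a + gap n <= b.
  by rewrite -lerBrDl gap_le lerDl andbT ltW ?gap_gt0.
have [g [g1 Sg go]] :=
  exists_diagonalizing_sequence K1s K2s K1inf K2inf K1S K2S ab lamP.
exists (span_closure g); split; first exact: span_closure_closed g1 go.
  exists (g 0%N); split; first exact: span_closure_mem g1 go 0%N.
  by move=> g0; have := g1 0%N; rewrite g0 nsq0 => /esym/eqP; rewrite oner_eq0.
move=> /min_attaining_minP[x [Mx x1 xmin]].
have x0 : x <> 0 by move=> x0; move: x1; rewrite x0 nsq0 => /esym/eqP; rewrite oner_eq0.
(* With [al = - a] and [be = 1] the form yields [|S x|^2 > a], and some [g n] falls below the
   supposed minimizer. *)
have pos n : 0 < - a + 1 * (a + gap n) by rewrite mul1r addKr gap_gt0.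
have := diagonal_form_gt0 Sb g1 Sg go pos Mx x0.
rewrite x1 mulr1 mul1r addrC => /gap_small[n nlt].
have := xmin _ (span_closure_mem g1 go n) (g1 n); rewrite Sg.
by rewrite -lerBlDl leNgt nlt.
Qed.

End AttainmentFailure.

(** * Kernels, ranges and the operator norm *)

Lemma kernel_subspace (T : {linear V -> V}) : subspace (kernel T).
Proof.
split=> [|c x y]; rewrite /kernel /=; first exact: linear0.
by move=> Tx Ty; rewrite linearP Tx Ty scaler0 addr0.
Qed.

Lemma op_range_subspace (T : {linear V -> V}) : subspace (op_range T).
Proof.
split=> [|c _ _ [x ->] [y ->]]; first by exists 0; rewrite linear0.
by exists (c *: x + y); rewrite linearP.
Qed.

Lemma bounded_sub (T S : V -> V) : bounded ip T -> bounded ip S ->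
  bounded ip (fun x => T x - S x).
Proof.
move=> [C TC] [D SD]; exists (C + D) => x; rewrite mulrDl.
apply: le_trans (hnormD _ _) _; rewrite hnormN.
exact: lerD.
Qed.

Lemma hnorm_le_opnorm (T : V -> V) x : bounded ip T -> nsq x = 1 ->
  hnorm ip (T x) <= opnorm ip T.
Proof.
move=> [C TC] /hnorm1P x1; apply: ub_le_sup; last by exists x.
by exists C => _ [z [_ z1 ->]]; rewrite -[C]mulr1 -z1.
Qed.

(** * Idempotents *)

Section Idempotent.
Variable T : {linear V -> V}.
Hypothesis Tb : bounded ip T.
Hypothesis Tidem : forall x, T (T x) = T x.

Lemma idempotent_on_range x : op_range T x -> T x = x.
Proof. by move=> [y ->]; apply: Tidem. Qed.

Lemma fin_dim_attaining : complete ip -> fin_dim (op_range T) \/ fin_dim (kernel T) ->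
  AN ip T /\ AM ip T.
Proof.
move=> cV fd; suff att M : closed_subspace ip M -> nonzero_set M ->
    norm_attaining_on ip M T /\ min_attaining_on ip M T.
  by split; split=> // M Mcl Mnz; case: (att M Mcl Mnz).
move: M; case: fd => [fR|[n [v vP]]].
  by apply: (@scalar_plus_finite_rank T T 0) => // x; rewrite scale0r add0r.
(* Here [T = I + F] with [F = T - I], and idempotence puts the range of [F] inside the kernel of
   [T]. *)
pose F : {linear V -> V} := T \- (@idfun V).
have FE x : F x = T x - x by [].
apply: (@scalar_plus_finite_rank T F 1) => //.
- by move=> x; rewrite FE scale1r addrC subrK.
- by apply: bounded_sub => //; exists 1 => x; rewrite mul1r.
- exists n, v => _ [x ->]; apply: vP.
  by change (T (T x - x) = 0); rewrite linearB Tidem subrr.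
Qed.

Lemma AM_fin_dim : AM ip T -> fin_dim (op_range T) \/ fin_dim (kernel T).
Proof.
move=> [_ TM]; apply: contrapT => /not_orP[Rinf Kinf].
have Kle x : kernel T x -> nsq x = 1 -> nsq (T x) <= 0 by move=> -> _; rewrite nsq0.
have Rge x : op_range T x -> nsq x = 1 -> 1 <= nsq (T x).
  by move=> /idempotent_on_range -> ->.
have [M [Mcl Mnz]] := exists_not_min_attaining Tb (kernel_subspace T)
  (op_range_subspace T) Kinf Rinf Kle Rge ltr01.
by apply; apply: TM.
Qed.

Lemma closure_AN_fin_dim :
  in_closure_AN ip T -> fin_dim (op_range T) \/ fin_dim (kernel T).
Proof.
move=> Tcl; apply: contrapT => /not_orP[Rinf Kinf].
(* On unit vectors, [S] has norm at most [1 / 4] over the kernel and at least [3 / 4] over the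
   range; any radius below [1 / 2] would leave such a gap. *)
have quarter : 0 < 1 / 4 :> R by lra.
have [S [[Sb SN] TS]] := Tcl _ quarter.
have near x : nsq x = 1 -> hnorm ip (T x - S x) <= 1 / 4.
  move=> x1; apply: le_trans (ltW TS).
  exact: (hnorm_le_opnorm (bounded_sub Tb Sb)).
have Kle x : kernel T x -> nsq x = 1 -> nsq (S x) <= (1 / 4) ^+ 2.
  move=> Kx /near; rewrite Kx sub0r hnormN hnorm_le_nsq //; lra.
have Rge x : op_range T x -> nsq x = 1 -> (3 / 4) ^+ 2 <= nsq (S x).
  move=> /idempotent_on_range Tx x1; have := near _ x1.
  have := hnormB x (S x); rewrite Tx (proj2 (hnorm1P x) x1) => h1 h2.
  rewrite -sqr_hnorm ler_pXn2r ?nnegrE ?hnorm_ge0 //; lra.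
have lt_ab : (1 / 4) ^+ 2 < (3 / 4) ^+ 2 :> R by lra.
have [M [Mcl Mnz]] := exists_not_norm_attaining Sb (kernel_subspace T)
  (op_range_subspace T) Kinf Rinf Kle Rge lt_ab.
by apply; apply: SN.
Qed.

End Idempotent.

Lemma AN_in_closure (T : {linear V -> V}) : infinite_dim V ->
  AN ip T -> in_closure_AN ip T.
Proof.
move=> /(_ 1%N)[v vfree] TN e e0; exists T; split=> //.
have v0 : v ord0 <> 0.
  move=> v0; have := vfree (fun=> 1); rewrite big_ord1 v0 scaler0.
  by move=> /(_ erefl ord0)/eqP; rewrite oner_eq0.
(* [T] approximates itself; the unit vector makes the set defining [opnorm] of the zero difference
   nonempty, as [ge_sup] requires. *)
have [r _ r1] := exists_normalized v0.
apply: le_lt_trans e0; apply: ge_sup.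
  by eexists; exists (real_complex R r *: v ord0); split=> //; apply/hnorm1P.
by move=> _ [x [_ _ ->]]; rewrite subrr hnorm0.
Qed.

End InnerProduct.

(** * The equivalence for idempotents *)

Theorem theorem6p1 (R : realType) (V : lmodType R[i]) (ip : V -> V -> R[i])
  (HH : inf_dim_separable_Hilbert ip)
  (T : {linear V -> V}) (Tb : bounded ip T) (Tidem : forall x : V, T (T x) = T x) :
  [<-> AN ip T;
       fin_dim (op_range T) \/ fin_dim (kernel T);
       AM ip T;
       in_closure_AN ip T].
Proof.
case: HH => ipP cV _ Vinf.
have fd_att := fin_dim_attaining ipP Tb Tidem cV.
have cl_fd := closure_AN_fin_dim ipP Tb Tidem.
have AN_cl := @AN_in_closure _ _ _ ipP T Vinf.
(* Finite dimensionality is the hub: (i) reaches it through the closure, while (iii) and (iv) return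
   to it and then use that it yields both attainment properties. *)
tfae.
- by move=> /AN_cl/cl_fd.
- by move=> /fd_att[].
- by move=> /(AM_fin_dim ipP Tb Tidem)/fd_att[/AN_cl].
- by move=> /cl_fd/fd_att[].
Qed.
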